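(* Let $G$ be a distance-regular graph of even order with valency $k$, $\lambda\geq 1$ and $\mu=1$. Then $G$ is $\left\lfloor \frac{k+1-\frac{k}{\lambda+1}}{2}\right\rfloor$-extendable.
   Context: All graphs are finite, simple and undirected. A connected graph $G$ of diameter $D$ is distance-regular if there are integers $b_0,\dots,b_{D-1},c_1,\dots,c_D$ such that for all vertices $x,y$ at distance $i$, the vertex $y$ has exactly $c_i$ neighbors at distance $i-1$ from $x$ (for $1\le i\le D$) and exactly $b_i$ neighbors at distance $i+1$ from $x$ (for $0\le i\le D-1$). Such a graph is regular of valency $k=b_0$. $\lambda$ is the number of common neighbors of any two adjacent vertices, and $\mu=c_2$ is the number of common neighbors of any two vertices at distance $2$ (so a hypothesis on $\mu$ presupposes $D\ge 2$). A matching is a set of edges no two of which share a vertex; it is perfect if every vertex is incident with one of its edges. A connected graph of even order $v$ is called $t$-extendable if it contains a perfect matching, $t<v/2$, and every matching of $t$ edges is contained in some perfect matching. *)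

(* Defs.v *)
From mathcomp Require Import all_boot all_order all_algebra.

Set Implicit Arguments.
Unset Strict Implicit.
Unset Printing Implicit Defensive.

Definition simple_graph (T : finType) (e : rel T) : Prop :=
  symmetric e /\ irreflexive e.

Definition connected_graph (T : finType) (e : rel T) : Prop :=
  0 < #|T| /\ forall x y : T, connect e x y.

Definition walk (T : finType) (e : rel T) (n : nat) (x y : T) : bool :=
  [exists p : n.-tuple T, path e x p && (last x p == y)].

(* The least length of a walk from x to y. Two vertices in the same component
   are joined by a walk of length < #|T|, so searching n < #|T| suffices; the
   value is the junk #|T| when x and y are in different components. *)
Definition dist (T : finType) (e : rel T) (x y : T) : nat :=
  find (fun n => walk e n x y) (iota 0 #|T|).

Definition diameter (T : finType) (e : rel T) : nat :=
  \max_(x : T) \max_(y : T) dist e x y.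

(* Only b i for i < diameter and c i for 1 <= i <= diameter are constrained;
   the other values of the functions b and c are irrelevant. *)
Definition distance_regular (T : finType) (e : rel T) (b c : nat -> nat) : Prop :=
  connected_graph e /\
  forall (i : nat) (x y : T), dist e x y = i ->
    (1 <= i <= diameter e -> #|[set z | e y z & dist e x z == i.-1]| = c i) /\
    (i < diameter e -> #|[set z | e y z & dist e x z == i.+1]| = b i).

Definition common_nbrs (T : finType) (e : rel T) (x y : T) : {set T} :=
  [set z | e x z & e y z].

Definition edges (T : finType) (e : rel T) : {set {set T}} :=
  [set [set x; y] | x in T, y in T & e x y].

Definition matching (T : finType) (e : rel T) (M : {set {set T}}) : bool :=
  (M \subset edges e) && trivIset M.

Definition perfect_matching (T : finType) (e : rel T) (M : {set {set T}}) : bool :=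
  matching e M && (cover M == [set: T]).

Definition extendable (T : finType) (e : rel T) (t : nat) : Prop :=
  [/\ connected_graph e,
      ~~ odd #|T|,
      exists P : {set {set T}}, perfect_matching e P,
      t < #|T|./2
    & forall M : {set {set T}}, matching e M -> #|M| = t ->
        exists2 P : {set {set T}}, perfect_matching e P & M \subset P].

(* Main.v *)
Require Import Defs.
From mathcomp Require Import all_boot all_order all_algebra perm.
From mathcomp Require Import zify ring lra.

(** Put s = lambda + 1, let k be the valency and D the diameter. Since c 2 = 1,
    two vertices at distance 2 have a single common neighbour, so the neighbours
    of any vertex split into disjoint cliques of size s with no edges between
    different cliques, and k >= 2 s because D >= 2. Two facts carry the proof.

    Vertex connectivity ([vertex_connectivity]): a set S whose removal leaves
    two nonempty sides A and B has at least k elements. Suppose |S| < k. First,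
    some vertex a of A has at most one neighbour in S
    ([sparse_boundary_vertex]): if every vertex of A had x >= 2 of them, then
    the neighbours in S of a and those of its neighbours in A would overlap so
    little that S would have k elements. Second, seen from such an a, the side B
    contains less than half of the graph ([far_side_half]). Indeed, the fraction
    of the distance layer Gamma_j(a) that lies in B grows from one layer to the
    next by at most the fraction of the layer that lies in S ([layer_flow]).
    The layers from the second to the one at distance D - 2 have at least as many
    elements as Gamma_2(a), that is at least s k, so the total growth is at most
    one half; small layers at distance D - 1 and D need a separate estimate. By
    symmetry A is also less than half of the graph, and then S would
    have more than k elements.

    Barriers ([berge_barrier]): in any finite graph there are a matching, a set
    S of vertices and at least m + |S| components outside S, where m is the
    number of vertices that the matching misses. This is the hard half of the
    Tutte-Berge formula, and it is derived from Gallai's lemma.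

    Suppose now that a matching M of at most t edges lies in no perfect
    matching, and apply the second fact to the graph without the 2 |M| vertices
    of M. By parity the matching found there misses at least two vertices, so
    the union W of S and the vertices of M leaves q >= |W| - 2 |M| + 2 >= 2
    components. By the first fact |W| >= k, and each component has at least k
    neighbours in W. A vertex of W has neighbours in at most k / s components,
    because each clique of its neighbourhood meets at most one of them. Counting
    adjacent pairs gives s q <= |W| ([separator_bound]), so
    s (|W| - 2 |M| + 2) <= |W|, and |W| >= k contradicts
    2 s |M| <= k lambda + s, which follows from the definition of t. *)

Set Implicit Arguments.
Unset Strict Implicit.
Unset Printing Implicit Defensive.

(** * Distance in a connected graph *)

Section Distance.

Variables (T : finType) (e : rel T).
Hypothesis e_sym : symmetric e.
Hypothesis e_conn : connected_graph e.

Lemma walkP n x y :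
  reflect (exists p, [/\ size p = n, path e x p & last x p = y]) (walk e n x y).
Proof.
apply: (iffP existsP) => [[p /andP[ep /eqP lp]]|[p [sp ep lp]]].
  by exists p; rewrite size_tuple.
by exists (tcast sp (in_tuple p)); rewrite val_tcast ep lp /=.
Qed.

Lemma walk0 x y : walk e 0 x y = (x == y).
Proof.
apply/walkP/eqP => [[p [/size0nil -> _ <-]] //|<-]; by exists [::].
Qed.

Lemma walk_cat m n x y z : walk e m x y -> walk e n y z -> walk e (m + n) x z.
Proof.
move=> /walkP[p [sp ep lp]] /walkP[q [sq eq lq]].
by apply/walkP; exists (p ++ q); rewrite size_cat cat_path last_cat sp sq ep lp eq lq.
Qed.

Lemma walk1 x y : walk e 1 x y = e x y.
Proof.
apply/walkP/idP => [[[|z [|? ?]] [] //= _ /andP[exz _] <-]|exy] //.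
by exists [:: y]; rewrite /= exy.
Qed.

Lemma walk_split m n x z :
  walk e (m + n) x z -> exists2 y, walk e m x y & walk e n y z.
Proof.
move=> /walkP[p [sp ep lp]]; exists (last x (take m p)).
  apply/walkP; exists (take m p); split=> //; last by rewrite take_path.
  by rewrite size_takel // sp leq_addr.
apply/walkP; exists (drop m p); rewrite size_drop sp addKn; split=> //.
  by move: ep; rewrite -{1}(cat_take_drop m p) cat_path => /andP[].
by rewrite -last_cat cat_take_drop.
Qed.

Lemma walk_sym n x y : walk e n x y = walk e n y x.
Proof.
elim: n x y => [|n IHn] x y; first by rewrite !walk0 eq_sym.
apply/idP/idP; rewrite -{1}addn1 => /walk_split[z wxz];
  by rewrite walk1 e_sym -walk1 IHn in wxz *; move=> wzy; apply: (walk_cat wzy).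
Qed.

(** Erasing the loops of a walk leaves a walk with fewer than [#|T|] steps, so
    the bounded search that defines [dist] succeeds in a connected graph. *)
Lemma walk_dist_lt x y : walk e (dist e x y) x y /\ dist e x y < #|T|.
Proof.
have hasw : has (fun n => walk e n x y) (iota 0 #|T|).
  have /connectP[p ep ->] := e_conn.2 x y.
  case/shortenP: ep => q eq uq _; apply/hasP; exists (size q).
    by rewrite mem_iota /= add0n; have := max_card (mem (x :: q)); rewrite (card_uniqP uq).
  by apply/walkP; exists q.
have := nth_find 0 hasw; move: hasw; rewrite has_find size_iota => lt_d.
by rewrite -/(dist e x y) nth_iota.
Qed.

Lemma walk_dist x y : walk e (dist e x y) x y.
Proof. by have [] := walk_dist_lt x y. Qed.

Lemma dist_min n x y : walk e n x y -> dist e x y <= n.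
Proof.
move=> wn; have [_ dT] := walk_dist_lt x y; rewrite leqNgt; apply/negP => ltn.
have := before_find 0 ltn.
by rewrite nth_iota ?wn //; apply: ltn_trans dT.
Qed.

Lemma dist_eq0 x y : (dist e x y == 0) = (x == y).
Proof.
apply/eqP/eqP => [d0|->]; first by apply/eqP; rewrite -walk0 -d0 walk_dist.
by apply/eqP; rewrite -leqn0 dist_min // walk0.
Qed.

Lemma distxx x : dist e x x = 0.
Proof. by apply/eqP; rewrite dist_eq0. Qed.

Lemma dist_sym x y : dist e x y = dist e y x.
Proof. by apply/eqP; rewrite eqn_leq !dist_min // walk_sym walk_dist. Qed.

Lemma dist_triangle y x z : dist e x z <= dist e x y + dist e y z.
Proof. by apply: dist_min; apply: walk_cat; apply: walk_dist. Qed.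

Lemma dist_edge x y z : e y z -> dist e x z <= (dist e x y).+1.
Proof.
move=> eyz; rewrite -addn1; apply: leq_trans (dist_triangle y x z) _.
by rewrite leq_add2l dist_min // walk1.
Qed.

Lemma dist1_edge x y : dist e x y = 1 -> e x y.
Proof. by move=> d1; have := walk_dist x y; rewrite d1 walk1. Qed.

Lemma dist_interpolate x y m n :
  dist e x y = m + n -> exists2 z, dist e x z = m & dist e z y = n.
Proof.
move=> dxy; have := walk_dist x y; rewrite dxy => /walk_split[z wxz wzy].
have := dist_min wxz; have := dist_min wzy; have := dist_triangle z x y.
by exists z; lia.
Qed.

Lemma dist_le_diam x y : dist e x y <= diameter e.
Proof.
apply: leq_trans (leq_bigmax (F := fun x => \max_y dist e x y) x).
exact: leq_bigmax.
Qed.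

Lemma diameter_attained : exists x y, dist e x y = diameter e.
Proof.
have [x Ex] := eq_bigmax (fun x => \max_y dist e x y) e_conn.1.
have [y Ey] := eq_bigmax (dist e x) e_conn.1.
by exists x, y; rewrite -Ey -Ex.
Qed.

(** Geodesics realise every admissible pair of distances: take an initial
    segment of a path between two vertices at maximal distance. *)
Lemma exists_dist i j : i + j <= diameter e ->
  exists x y z, [/\ dist e x y = i, dist e y z = j & dist e x z = i + j].
Proof.
have [x [y dxy]] := diameter_attained => le_ij.
have /dist_interpolate[z dxz _] : dist e x y = (i + j) + (diameter e - (i + j)).
  by rewrite dxy; lia.
by have [w dxw dwz] := dist_interpolate dxz; exists x, w, z.
Qed.

End Distance.

(** * Matchings as involutions, and barriers *)

Section InvolutiveMatching.

Variables (T : finType) (e : rel T).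
Hypotheses (e_sym : symmetric e) (e_irr : irreflexive e).
Implicit Types (U S X : {set T}) (f g : {ffun T -> T}).

(** A matching of the vertices in [U] is encoded as an involution that fixes all
    unmatched vertices and all vertices outside [U]. Replacing an edge of the
    matching by another one then is conjugation by a transposition. *)
Definition imatching U f : bool :=
  [forall w, (f (f w) == w) && ((f w != w) ==> (w \in U) && e w (f w))].

Definition missed U f : {set T} := [set w in U | f w == w].

Definition maximum U f : bool :=
  imatching U f &&
  [forall g, imatching U g ==> (#|missed U f| <= #|missed U g|)].

Definition connect_in U : rel T :=
  connect [rel x y | [&& x \in U, y \in U & e x y]].

Lemma imatchingP U f :
  reflect (involutive f /\ forall w, f w != w -> w \in U /\ e w (f w))
          (imatching U f).
Proof.
apply: (iffP forallP) => [mf|[ff fe] w].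
  split=> w; first by have /andP[/eqP] := mf w.
  by have /andP[_ /implyP fw] := mf w; move/fw/andP.
by rewrite ff eqxx; apply/implyP => /fe[-> ->].
Qed.

Lemma maximumP U f :
  reflect (imatching U f /\
           forall g, imatching U g -> #|missed U f| <= #|missed U g|)
          (maximum U f).
Proof.
apply: (iffP andP) => -[mf maxf]; split=> //.
  by move=> g mg; apply: (implyP (forallP maxf g)).
by apply/forallP => g; apply/implyP/maxf.
Qed.

Lemma exists_maximum U : exists f, maximum U f.
Proof.
have id_m : imatching U [ffun w => w].
  by apply/imatchingP; split=> w; rewrite !ffunE ?eqxx.
have [f mf minf] := arg_minnP (fun f => #|missed U f|) id_m.
by exists f; apply/maximumP.
Qed.

Lemma involution_even (A : {set T}) (f : T -> T) : involutive f ->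
  {in A, forall w, f w \in A} -> {in A, forall w, f w != w} -> ~~ odd #|A|.
Proof.
move=> ff; have [n] := ubnP #|A|; elim: n A => // n IHn A leAn fA nfix.
have [->|[w wA]] := set_0Vmem A; first by rewrite cards0.
have fwA : f w \in A :\ w by rewrite !inE nfix ?fA.
have cA : #|A| = #|A :\ w :\ f w|.+2.
  by rewrite (cardsD1 w A) wA (cardsD1 (f w) (A :\ w)) fwA.
rewrite cA /= negbK; apply: IHn; first by lia.
  move=> z; rewrite !inE => /and3P[zfw zw zA].
  by rewrite (inv_eq ff) ff (can2_eq ff ff) zw zfw fA.
by move=> z; rewrite !inE => /and3P[_ _]; apply: nfix.
Qed.

Lemma odd_missed U f : imatching U f -> odd #|missed U f| = odd #|U|.
Proof.
move=> /imatchingP[ff fe].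
have sM : missed U f \subset U by apply/subsetP => w; rewrite inE => /andP[].
have mem w : (w \in U :\: missed U f) = (f w != w).
  rewrite !inE; case: (boolP (w \in U)) => wU //=; first by rewrite andbT.
  by apply/esym/negbTE; rewrite negbK; apply: contraR wU => /fe[].
have := cardsID (missed U f) U; rewrite (setIidPr sM) => <-; rewrite oddD.
have /negbTE -> : ~~ odd #|U :\: missed U f|; last by rewrite addbF.
apply: (involution_even ff) => w; rewrite !mem // ff => /eqP fw.
by apply/eqP => /esym.
Qed.

(** Otherwise the edge between [u] and [v] could be added to the matching. *)
Lemma maximum_missed_nonadjacent U f u v :
  maximum U f -> u \in missed U f -> v \in missed U f -> ~~ e u v.
Proof.
move=> /maximumP[/imatchingP[ff fe] maxf].
rewrite !inE => /andP[uU /eqP fu] /andP[vU /eqP fv]; apply/negP => euv.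
have uv : v != u by apply: contraTneq euv => ->; rewrite e_irr.
pose g := [ffun w => if w == u then v else if w == v then u else f w].
have gu : g u = v by rewrite ffunE eqxx.
have gv : g v = u by rewrite ffunE (negbTE uv) eqxx.
have gw w : w != u -> w != v -> g w = f w.
  by rewrite ffunE => /negbTE -> /negbTE ->.
have mg : imatching U g.
  apply/imatchingP; split=> w.
    have [->|wu] := eqVneq w u; first by rewrite gu gv.
    have [->|wv] := eqVneq w v; first by rewrite gv gu.
    by rewrite gw // gw ?ff //; [rewrite -fu | rewrite -fv];
      rewrite (inj_eq (inv_inj ff)).
  have [->|wu] := eqVneq w u; first by rewrite gu.
  have [->|wv] := eqVneq w v; first by rewrite gv e_sym.
  by rewrite gw //; apply: fe.
have := maxf _ mg; rewrite leqNgt => /negP[]; apply: proper_card.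
apply/properP; split; last first.
  by exists u; rewrite !inE ?uU ?fu ?gu ?eqxx ?(negbTE uv).
apply/subsetP => w; rewrite !inE => /andP[-> gww] /=.
have [wu|wu] := eqVneq w u; first by rewrite wu gu (negbTE uv) in gww.
have [wv|wv] := eqVneq w v; first by rewrite wv gv eq_sym (negbTE uv) in gww.
by rewrite gw in gww.
Qed.

Section Gallai.

Variable U : {set T}.
Hypothesis all_missable : forall v, v \in U -> exists2 f, maximum U f & f v == v.

(** [M] matches [x], a vertex missed by [N], to [M x], which [N] matches to [z].
    Trading the edge of [N] between [M x] and [z] for the edge of [M] between
    [x] and [M x] keeps [N] maximum and makes it agree with [M] at one more
    vertex at least; as a permutation, the new matching is the conjugate of [N]
    by the transposition of [x] and [z]. *)
Lemma gallai_transfer M N x z : maximum U M -> maximum U N ->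
  N x = x -> N (M x) = z -> M x != x -> z != M x ->
  let N' := [ffun w => tperm x z (N (tperm x z w))] in
  maximum U N' /\ #|[set w | M w == N w]| < #|[set w | M w == N' w]|.
Proof.
move=> /maximumP[/imatchingP[MM Me] maxM] /maximumP[/imatchingP[NN Ne] maxN].
move=> Nx Ny Mx zy N'; set y := M x in Ny Mx zy *.
have My : M y = x by apply: MM.
have Nz : N z = y by rewrite -Ny NN.
have xy : x != y by rewrite eq_sym.
have xz : x != z by apply: contraNneq Mx => xz; rewrite -[y]NN Ny -xz Nx.
have N'x : N' x = y by rewrite ffunE tpermL Nz tpermD.
have N'z : N' z = z by rewrite ffunE tpermR Nx tpermL.
have N'y : N' y = x by rewrite ffunE (tpermD xy zy) Ny tpermR.
have N'w w : w != x -> w != y -> w != z -> N' w = N w.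
  move=> wx wy wz; rewrite ffunE (tpermD (z := w)) 1?eq_sym // tpermD //.
    by rewrite -Nx (inj_eq (inv_inj NN)) eq_sym.
  by rewrite -Ny (inj_eq (inv_inj NN)) eq_sym.
have [xU exy] : x \in U /\ e x y by apply: Me.
have [yU _] : y \in U /\ e y (M y) by apply: Me; rewrite My eq_sym.
have [zU _] : z \in U /\ e z (N z) by apply: Ne; rewrite Nz eq_sym.
have mN' : imatching U N'.
  apply/imatchingP; split=> w; first by rewrite !ffunE tpermK NN tpermK.
  have [->|wx] := eqVneq w x; first by rewrite N'x.
  have [->|wy] := eqVneq w y; first by rewrite N'y e_sym.
  have [->|wz] := eqVneq w z; first by rewrite N'z eqxx.
  by rewrite N'w //; apply: Ne.
split.
  apply/maximumP; split=> // g /maxN; apply: leq_trans.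
  rewrite -(card_imset _ (@perm_inj _ (tperm x z))); apply: subset_leq_card.
  apply/subsetP => _ /imsetP[w + ->]; rewrite !inE => /andP[wU].
  rewrite ffunE (can2_eq (tpermK _ _) (tpermK _ _)) => ->; rewrite andbT.
  by case: tpermP.
apply: proper_card; apply/properP; split; last first.
  by exists x; rewrite !inE ?N'x ?Nx ?eqxx.
apply/subsetP => w; rewrite !inE.
have [->|wx] := eqVneq w x; first by rewrite N'x.
have [->|wy] := eqVneq w y; first by rewrite N'y My.
have [->|wz] := eqVneq w z; last by rewrite N'w.
by rewrite Nz /y (inj_eq (inv_inj MM)) eq_sym (negbTE xz).
Qed.

Definition never_both u v :=
  forall f, maximum U f -> u \in missed U f -> v \in missed U f -> u = v.

(** Gallai's exchange argument. If a maximum [M] missed both [u] and [v], choose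
    a maximum [N] missing [t] that agrees with [M] as much as possible. [N]
    covers [u] and [v], and it misses as many vertices as [M], so it misses some
    [x] other than [t] that [M] covers. The partner of [x] in [M] is covered by
    [N], and [gallai_transfer] yields a matching missing [t] that agrees even
    more with [M]. *)
Lemma never_both_trans t u v : t \in U ->
  never_both u t -> never_both t v -> never_both u v.
Proof.
move=> tU ut tv M maxM uM vM; apply/eqP/negPn/negP => uv.
have [N0 maxN0 tN0] := all_missable tU.
pose missing_t := [pred N : {ffun T -> T} | maximum U N & N t == t].
have PN0 : missing_t N0 by rewrite /= maxN0.
have [N /andP[maxN /eqP Nt] agreeN] :=
  @arg_maxnP _ N0 missing_t (fun N => #|[set w | M w == N w]|) PN0.
have tN : t \in missed U N by rewrite inE tU Nt eqxx.
have ntu : t != u.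
  by apply: contraNneq uv => tu; rewrite -tu; apply/eqP/(tv M); rewrite // tu.
have ntv : t != v.
  by apply: contraNneq uv => tv'; rewrite -tv'; apply/eqP/(ut M); rewrite // tv'.
have uN : u \notin missed U N.
  by apply: contraNN ntu => uN; rewrite eq_sym; apply/eqP/(ut N).
have vN : v \notin missed U N by apply: contraNN ntv => vN; apply/eqP/(tv N).
have [/imatchingP[MM Me] minM] := maximumP _ _ maxM.
have [/imatchingP[NN Ne] minN] := maximumP _ _ maxN.
have [x xNM xt] : exists2 x, x \in missed U N :\: missed U M & x != t.
  have card_eq : #|missed U N| = #|missed U M|.
    by apply/eqP; rewrite eqn_leq minN ?minM //; apply/imatchingP.
  have : 1 < #|missed U N :\: missed U M|.
    have : 1 < #|missed U M :\: missed U N|.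
      have <- : #|[set u; v]| = 2 by rewrite cards2 uv.
      by apply: subset_leq_card; apply/subsetP => w /set2P[] ->; apply/setDP.
    by rewrite !cardsD card_eq setIC.
  rewrite (cardsD1 t) => lt1.
  have /card_gt0P[x] : 0 < #|(missed U N :\: missed U M) :\ t|.
    by move: lt1; case: (t \in _) => //; apply: ltnW.
  by rewrite in_setD1 => /andP[]; exists x.
have {xNM} [xN xM] := setDP xNM.
have [xU /eqP Nx] : x \in U /\ N x == x by apply/andP; rewrite inE in xN.
have Mx : M x != x by move: xM; rewrite inE xU.
have NMx : N (M x) != M x.
  apply/negP => NMx; have [_ exMx] := Me _ Mx.
  have [|MxU _] := Me (M x); first by rewrite MM eq_sym.
  have := maximum_missed_nonadjacent maxN xN (v := M x).
  by rewrite inE MxU NMx exMx => /(_ isT).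
have [maxN' lt_agree] := gallai_transfer maxM maxN Nx (erefl _) Mx NMx.
move: maxN' lt_agree; set N' := finfun _ => maxN'; rewrite ltnNge => /negP[].
apply: agreeN; rewrite /= maxN' ffunE.
have tNMx : t != N (M x).
  apply: contraTneq isT => tE; have : M x = t by rewrite -Nt tE NN.
  by move=> Mxt; move: NMx; rewrite Mxt Nt eqxx.
by rewrite (tpermD (z := t)) ?Nt ?tpermD 1?eq_sym //= 1?eq_sym.
Qed.

Lemma gallai u v : u \in U -> connect_in U u v -> never_both u v.
Proof.
move=> uU /connectP[p ep ->]; elim: p u uU ep => [|w p IHp] u uU /=.
  by move=> _ f _ _ _.
move=> /andP[/and3P[_ wU euw] ep].
apply: (never_both_trans wU); last exact: IHp.
by move=> f maxf uf wf; have := maximum_missed_nonadjacent maxf uf wf; rewrite euw.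
Qed.

End Gallai.

(** The hard half of the Tutte-Berge formula; [X] represents components of the
    graph induced on [U :\: S]. If every maximum matching covers some vertex [v],
    deleting [v] leaves one more missed vertex, and [v] is put into the barrier
    [S]. Otherwise Gallai's lemma says that the vertices missed by one maximum
    matching lie in pairwise distinct components, and the empty barrier works. *)
Theorem berge_barrier U : exists f S X,
  [/\ imatching U f, S \subset U, X \subset U :\: S,
      {in X &, forall x y, connect_in (U :\: S) x y -> x = y}
    & #|missed U f| + #|S| <= #|X|].
Proof.
have [n] := ubnP #|U|; elim: n U => // n IHn U leUn.
have [f maxf] := exists_maximum U; have [mf minf] := maximumP _ _ maxf.
case: (boolP [exists v in U, [forall g, maximum U g ==> (g v != v)]]).
  case/exists_inP => v vU /forallP covered.
  have [|f' [S [X [mf' sS sX discX leX]]]] := IHn (U :\ v).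
    by move: leUn; rewrite (cardsD1 v) vU.
  have [ff' ef'] := imatchingP _ _ mf'.
  have {mf'} mf' : imatching U f'.
    by apply/imatchingP; split=> // w /ef'[/setD1P[]].
  have f'v : f' v = v.
    by apply/eqP/negPn/negP => /ef'[]; rewrite !inE eqxx.
  have missE : #|missed U f'| = #|missed (U :\ v) f'|.+1.
    rewrite (cardsD1 v) inE vU f'v eqxx add1n; congr _.+1; apply: eq_card => w.
    by rewrite !inE andbA.
  have lt_miss : #|missed U f| < #|missed U f'|.
    rewrite ltnNge; apply: contraTN (covered f') => le_miss.
    rewrite f'v eqxx implybF negbK; apply/maximumP; split=> // g /minf.
    exact: leq_trans.
  have US : U :\: (v |: S) = (U :\ v) :\: S.
    by apply/setP => w; rewrite !inE negb_or; case: (w == v); case: (w \in S).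
  exists f, (v |: S), X; rewrite US; split=> //.
    by rewrite subUset sub1set vU (subset_trans sS) // subD1set.
  have vS : v \notin S by apply/negP => /(subsetP sS); rewrite !inE eqxx.
  (* By parity, a matching of [U] better than [f'] misses two vertices fewer. *)
  rewrite cardsU1 vS /=; have := odd_missed mf; rewrite -(odd_missed mf').
  lia.
move/exists_inPn => missable.
exists f, set0, (missed U f); rewrite cards0 addn0 setD0 sub0set; split=> //.
  by apply/subsetP => w; rewrite inE => /andP[].
move=> x y xf yf cxy; move: (xf) => /[!inE] /andP[xU _].
apply: (gallai _ xU cxy maxf xf yf) => v /missable/forallPn[g].
by rewrite negb_imply negbK => /andP[]; exists g.
Qed.

Lemma card_cover_matching (M : {set {set T}}) : matching e M -> #|cover M| = 2 * #|M|.
Proof.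
move=> /andP[/subsetP Me trivM].
rewrite -(eqP trivM) (eq_bigr (fun=> 2)) ?sum_nat_const ?[2 * _]mulnC //.
move=> _ /Me/imset2P[x y _ + ->]; rewrite inE => exy; rewrite cards2.
by case: eqVneq exy => // ->; rewrite e_irr.
Qed.

Lemma matching_glue (M : {set {set T}}) f : matching e M ->
  imatching (~: cover M) f -> missed (~: cover M) f = set0 ->
  exists2 P, perfect_matching e P & M \subset P.
Proof.
move=> /andP[/subsetP Me trivM] /imatchingP[ff fe] nomiss.
set U := ~: cover M in fe nomiss.
have fU x : x \in U -> f x != x.
  by move=> xU; apply/negP => fx; have := in_set0 x; rewrite -nomiss inE fx xU.
pose F := [set [set x; f x] | x in U].
have F_sub A : A \in F -> A \subset U.
  case/imsetP => x xU ->; rewrite subUset !sub1set xU.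
  by have [|->] := fe (f x); rewrite // ff eq_sym fU.
have F_pair A z : A \in F -> z \in A -> A = [set z; f z].
  by case/imsetP => x xU -> /set2P[] ->; rewrite // ff setUC.
have M_F A B : A \in M -> B \in F -> [disjoint A & B].
  move=> AM /F_sub BU; rewrite disjoint_sym; apply: (disjointWl BU).
  by rewrite disjoints_subset setCS bigcup_sup.
exists (M :|: F); last exact: subsetUl.
apply/andP; split; [apply/andP; split|].
- apply/subsetP => A /setUP[/Me //|/imsetP[x xU ->]].
  by apply/imset2P; exists x (f x); rewrite // inE; have [] := fe x (fU x xU).
- apply/trivIsetP => A B /setUP[] AX /setUP[] BX AB.
  + by apply: (trivIsetP trivM).
  + exact: M_F.
  + by rewrite disjoint_sym M_F.
  + rewrite -setI_eq0; apply: contraNT AB => /set0Pn[z /setIP[zA zB]].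
    by rewrite (F_pair A z) // (F_pair B z).
- apply/eqP/setP => x; rewrite inE; apply/bigcupP.
  have [xM|xU] := boolP (x \in cover M).
    by have /bigcupP[A AM xA] := xM; exists A; rewrite // inE AM.
  exists [set x; f x]; last by rewrite !inE eqxx.
  by rewrite inE; apply/orP; right; apply: imset_f; rewrite inE.
Qed.

End InvolutiveMatching.

(** * Layers of a distance-regular graph *)

Lemma double_count (T : finType) (r : rel T) (P Q : {set T}) :
  \sum_(y in P) #|[set z in Q | r y z]| = \sum_(z in Q) #|[set y in P | r y z]|.
Proof.
have cE (X : {set T}) (p : pred T) : #|[set z in X | p z]| = \sum_(z in X) p z.
  rewrite -sum1_card big_mkcond [RHS]big_mkcond /=; apply: eq_bigr => z _.
  by rewrite inE; case: (z \in X); case: (p z).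
under eq_bigr do rewrite cE.
by rewrite exchange_big; apply: eq_bigr => z _; rewrite cE.
Qed.

Section DistanceLayers.

Variables (T : finType) (e : rel T) (b c : nat -> nat).
Hypotheses (e_sym : symmetric e) (drg_e : distance_regular e b c).

Let e_conn : connected_graph e := drg_e.1.
Let D := diameter e.

Definition layer (x : T) (i : nat) : {set T} := [set y | dist e x y == i].

Lemma card_down x y i : 0 < i -> dist e x y = i ->
  #|[set z in layer x i.-1 | e y z]| = c i.
Proof.
move=> i0 dxy; have [downE _] := drg_e.2 i x y dxy.
rewrite -downE; first by apply: eq_card => z; rewrite !inE andbC.
by rewrite i0 -dxy dist_le_diam.
Qed.

Lemma card_up x y i : i < D -> dist e x y = i ->
  #|[set z in layer x i.+1 | e y z]| = b i.
Proof.
move=> iD dxy; have [_ <- //] := drg_e.2 i x y dxy.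
by apply: eq_card => z; rewrite !inE andbC.
Qed.

Lemma b_gt0 i : i < D -> 0 < b i.
Proof.
move=> iD; have [|x [y [z [dxy dyz dxz]]]] := @exists_dist _ _ e_conn i 1.
  by rewrite addn1.
rewrite -(card_up iD dxy); apply/card_gt0P; exists z.
by rewrite !inE dxz addn1 eqxx (dist1_edge e_conn dyz).
Qed.

Lemma c_gt0 i : 0 < i <= D -> 0 < c i.
Proof.
case: i => // i /= iD.
have [|x [y [z [dxy dyz dxz]]]] := @exists_dist _ _ e_conn i 1.
  by rewrite addn1.
rewrite addn1 in dxz; rewrite -(card_down _ dxz) //; apply/card_gt0P; exists y.
by rewrite !inE dxy eqxx e_sym (dist1_edge e_conn dyz).
Qed.

(** The three comparisons below nest neighbourhoods along a geodesic. If it runs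
    from [x] through [w] to [z], a step from [z] away from [x] also leads away
    from [w], and a step from [z] towards [w] also leads towards [x]. A step from
    an inner vertex towards one end leads away from the other end. *)
Lemma b_antitone i : i.+1 < D -> b i.+1 <= b i.
Proof.
move=> iD; have [|x [w [z [dxw dwz dxz]]]] := @exists_dist _ _ e_conn 1 i.
  by rewrite add1n ltnW.
rewrite -(card_up iD dxz) -(card_up (ltnW iD) dwz); apply: subset_leq_card.
apply/subsetP => u; rewrite !inE => /andP[/eqP dxu ezu]; rewrite ezu andbT.
have := dist_triangle e_conn w x u; have := dist_edge e_conn w ezu; lia.
Qed.

Lemma c_monotone i : 0 < i -> i < D -> c i <= c i.+1.
Proof.
move=> i0 iD; have [|x [w [z [dxw dwz dxz]]]] := @exists_dist _ _ e_conn 1 i.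
  by rewrite add1n.
rewrite add1n in dxz; rewrite -(card_down _ dxz) // -(card_down i0 dwz).
apply: subset_leq_card; apply/subsetP => u; rewrite !inE => /andP[/eqP dwu ezu].
rewrite ezu andbT; rewrite e_sym in ezu.
have := dist_triangle e_conn w x u; have := dist_edge e_conn x ezu; lia.
Qed.

Lemma c_le_b i j : 0 < j -> i + j <= D -> c j <= b i.
Proof.
move=> j0 ijD; have [x [z [y [dxz dzy dxy]]]] := exists_dist e_conn ijD.
have iD : i < D by lia.
rewrite -(card_up iD dxz); rewrite dist_sym // in dzy; rewrite -(card_down j0 dzy).
apply: subset_leq_card; apply/subsetP => u; rewrite !inE => /andP[/eqP dyu ezu].
rewrite ezu andbT; have := dist_triangle e_conn u x y.
have := dist_edge e_conn x ezu; rewrite (dist_sym _ _ u y) //; lia.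
Qed.

Lemma layer0 x : layer x 0 = [set x].
Proof. by apply/setP => y; rewrite !inE dist_eq0 // eq_sym. Qed.

Lemma layer_count x i : i < D -> #|layer x i.+1| * c i.+1 = #|layer x i| * b i.
Proof.
move=> iD; have := double_count e (layer x i.+1) (layer x i).
rewrite (eq_bigr (fun=> c i.+1)) => [|y /[!inE] /eqP dy]; last first.
  by rewrite -(card_down _ dy).
rewrite [in RHS](eq_bigr (fun=> b i)) => [|y /[!inE] /eqP dy].
  by rewrite !sum_nat_const.
rewrite -(card_up iD dy); apply: eq_card => z; by rewrite !inE e_sym.
Qed.

Lemma layer_gt0 x i : i <= D -> 0 < #|layer x i|.
Proof.
elim: i => [|i IHi] iD; first by rewrite layer0 cards1.
have := layer_count x iD; have := b_gt0 iD; have := IHi (ltnW iD); nia.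
Qed.

(** The sizes of consecutive layers have ratio [b i / c i.+1]. By [c_le_b] the
    product of the ratios from [i] to [j] is at least 1: pair the numerator at
    one end with the denominator at the other end, and move inwards. *)
Lemma layer_mono x i j : i <= j -> i + j <= D -> #|layer x i| <= #|layer x j|.
Proof.
have [n] := ubnP (j - i); elim: n i j => // n IHn i j lt_n le_ij ijD.
have [->//|neq_ij] := eqVneq i j.
have lt_ij : i < j by rewrite ltn_neqAle neq_ij.
case: j => // j in lt_n le_ij ijD neq_ij lt_ij *.
have Ei : #|layer x i.+1| * c i.+1 = #|layer x i| * b i.
  by apply: layer_count; lia.
have Ej : #|layer x j.+1| * c j.+1 = #|layer x j| * b j.
  by apply: layer_count; lia.
have ci : 0 < c i.+1 by apply: c_gt0; lia.
have cj : 0 < c j.+1 by apply: c_gt0; lia.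
have bi : c j.+1 <= b i by apply: c_le_b; lia.
have [ij|lt_ij'] : i = j \/ i < j by lia.
  by rewrite ij in bi *; rewrite -(leq_pmul2r cj) Ej leq_mul2l bi orbT.
have bj : c i.+1 <= b j by apply: c_le_b; lia.
have IH : #|layer x i.+1| <= #|layer x j| by apply: IHn; lia.
have cc : 0 < c j.+1 * c i.+1 by rewrite muln_gt0 cj.
rewrite -(leq_pmul2r cc) [X in _ <= X]mulnA Ej.
apply: leq_trans (leq_mul (leqnn _) (leq_mul bi bj)) _.
by rewrite mulnA -Ei [X in _ <= X]mulnAC !leq_mul.
Qed.

Lemma sum_layers x (B : {set T}) :
  #|B| = \sum_(0 <= i < D.+1) #|B :&: layer x i|.
Proof.
rewrite big_mkord -sum1_card.
rewrite (partition_big (fun y => inord (dist e x y) : 'I_D.+1) xpredT) //=.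
apply: eq_bigr => i _; rewrite -sum1_card; apply: eq_bigl => y.
rewrite !inE; congr (_ && _); rewrite -val_eqE /= inordK //.
by rewrite ltnS dist_le_diam.
Qed.

Definition boundary_in (S A : {set T}) : Prop :=
  forall x y, x \in A -> e x y -> y \in A :|: S.

(** In fractions of a layer, B(i+1) <= B(i) + S(i): a vertex of [B] in layer
    [i.+1] has all of its [c i.+1] neighbours in layer [i] inside [B] or [S], and
    each vertex of layer [i] has [b i] neighbours in layer [i.+1]. *)
Lemma layer_flow x i (S B : {set T}) : boundary_in S B -> i < D ->
  #|B :&: layer x i.+1| * #|layer x i|
    <= (#|B :&: layer x i| + #|S :&: layer x i|) * #|layer x i.+1|.
Proof.
move=> bdB iD; have ci : 0 < c i.+1 by rewrite c_gt0.
have edge_bound : #|B :&: layer x i.+1| * c i.+1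
    <= (#|B :&: layer x i| + #|S :&: layer x i|) * b i.
  have := double_count e (B :&: layer x i.+1) ((B :|: S) :&: layer x i).
  rewrite (eq_bigr (fun=> c i.+1)) => [|y]; last first.
    rewrite !inE => /andP[yB /eqP dy]; rewrite -(card_down _ dy) //.
    apply: eq_card => z; rewrite !inE /=; case: (boolP (e y z)) => eyz.
      by have := bdB y z yB eyz; rewrite inE => ->.
    by rewrite !andbF.
  rewrite sum_nat_const => ->.
  apply: (@leq_trans (#|(B :|: S) :&: layer x i| * b i)).
    rewrite -sum_nat_const; apply: leq_sum => y; rewrite !inE => /andP[_ /eqP dy].
    rewrite -(card_up iD dy); apply: subset_leq_card; apply/subsetP => z.
    by rewrite !inE => /andP[/andP[_ ->]]; rewrite e_sym.
  by rewrite leq_mul2r setIUl cardsU leq_subr orbT.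
rewrite -(leq_pmul2r ci) -[X in _ <= X]mulnA layer_count // [X in _ <= X]mulnCA.
by rewrite mulnAC mulnC leq_mul.
Qed.

End DistanceLayers.

(** * Clique structure and vertex connectivity when mu is 1 *)

Section MuOne.

Variables (T : finType) (e : rel T) (b c : nat -> nat) (lambda : nat).
Hypotheses (e_sym : symmetric e) (e_irr : irreflexive e).
Hypothesis drg_e : distance_regular e b c.
Hypothesis lambdaP : forall x y : T, e x y -> #|common_nbrs e x y| = lambda.
Hypothesis lambda_ge1 : 1 <= lambda.
Hypothesis diam_ge2 : 2 <= diameter e.
Hypothesis mu_eq1 : c 2 = 1.

Let e_conn : connected_graph e := drg_e.1.
Let D := diameter e.
Let k := b 0.

Definition near : rel T := [rel x y | (x == y) || e x y].

Lemma near_sym : symmetric near.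
Proof. by move=> x y; rewrite /near /= eq_sym e_sym. Qed.

Lemma layer1 x : layer e x 1 = [set y | e x y].
Proof.
apply/setP => y; rewrite !inE; apply/eqP/idP => [|exy]; first exact: dist1_edge.
apply/eqP; rewrite eqn_leq dist_min ?walk1 // lt0n dist_eq0 //.
by apply: contraTneq exy => ->; rewrite e_irr.
Qed.

Lemma dist2 x y z : x != y -> ~~ e x y -> e x z -> e z y -> dist e x y = 2.
Proof.
move=> xy nexy exz ezy; apply/eqP; rewrite eqn_leq.
have := dist_edge e_conn x ezy.
have : z \in layer e x 1 by rewrite layer1 inE.
have : y \notin layer e x 1 by rewrite layer1 inE.
have := dist_eq0 e_conn x y; rewrite (negbTE xy) !inE.
by case: (dist e x y) => [|[|n]] // _ _ /eqP -> ->.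
Qed.

Lemma degree x : #|[set y | e x y]| = k.
Proof.
rewrite -layer1 /k -(card_up drg_e (i := 0) (x := x) (y := x)) ?distxx //.
  by apply: eq_card => y; rewrite layer1 !inE andbb.
exact: ltnW.
Qed.

Lemma common_nbr_unique x y z w : x != y -> ~~ e x y ->
  e x z -> e y z -> e x w -> e y w -> z = w.
Proof.
move=> xy nexy exz eyz exw eyw.
have dxy : dist e x y = 2 by apply: (dist2 xy nexy exz); rewrite e_sym.
have := card_down drg_e (i := 2) isT dxy; rewrite mu_eq1 layer1 => /eqP/cards1P[u E].
have : z \in [set u] by rewrite -E !inE exz.
have : w \in [set u] by rewrite -E !inE exw.
by rewrite !inE => /eqP -> /eqP ->.
Qed.

(** Inside the neighbourhood of [p], being equal or adjacent is transitive, for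
    two nonadjacent neighbours of [p] have no other common neighbour than [p].
    Hence this neighbourhood is a disjoint union of cliques. *)
Lemma near_trans p x y z : e p x -> e p y -> e p z ->
  near x y -> near y z -> near x z.
Proof.
rewrite /near /= => epx epy epz /orP[/eqP -> //|exy] /orP[/eqP <-|eyz].
  by rewrite exy orbT.
case: (eqVneq x z) => //= xz; apply/negPn/negP => nexz.
have yp : y = p by apply: (common_nbr_unique xz nexz); rewrite // e_sym.
by rewrite yp e_irr in epy.
Qed.

Lemma card_line p z : e p z -> #|[set u in [set u | e p u] | near z u]| = lambda.+1.
Proof.
move=> epz; rewrite -(lambdaP epz) (cardsD1 z) !inE epz /near /= eqxx; congr _.+1.
apply: eq_card => u; rewrite !inE eq_sym.
by case: (eqVneq z u) => // <-; rewrite e_irr andbF.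
Qed.

Lemma valency_split : k = lambda.+1 + b 1.
Proof.
have [x [w [_ [dxw _ _]]]] := @exists_dist _ _ e_conn 1 1 diam_ge2.
have exw := dist1_edge e_conn dxw; rewrite e_sym in exw.
rewrite -(degree w) -(card_line exw) -(card_up drg_e diam_ge2 dxw).
rewrite -(cardsID [set u | near x u] [set u | e w u]); congr (_ + _).
  by apply: eq_card => u; rewrite !inE.
apply: eq_card => u; rewrite !inE negb_or andbC [RHS]andbC.
case: (boolP (e w u)) => //= ewu; apply/andP/eqP => [[xu nexu]|dxu].
  by apply: (dist2 xu nexu _ ewu); rewrite e_sym.
split; first by rewrite -(dist_eq0 e_conn) dxu.
by apply/negP => exu; have := dist_min e_conn (n := 1) (x := x) (y := u);
  rewrite walk1 dxu => /(_ exu).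
Qed.

(** The cliques around the vertices of [Y] are disjoint parts of size
    [lambda.+1] of the neighbourhood of [p]. *)
Lemma spread_card p (Y : {set T}) : {in Y, forall y, e p y} ->
  {in Y &, forall y z, near y z -> y = z} -> lambda.+1 * #|Y| <= k.
Proof.
move=> pY spread; have := double_count near Y [set u | e p u].
rewrite (eq_bigr (fun=> lambda.+1)) => [|y /pY]; last exact: card_line.
rewrite sum_nat_const mulnC => ->; rewrite -(degree p) -sum1_card.
apply: leq_sum => u; rewrite inE => epu.
apply/card_le1_eqP => y z; rewrite !inE => /andP[yY uy] /andP[zY uz].
apply: spread => //; apply: (near_trans _ epu); rewrite ?pY //.
by rewrite near_sym.
Qed.

Lemma b1_gt_lambda : lambda < b 1.
Proof.
have [x [w [z [dxw dwz dxz]]]] := @exists_dist _ _ e_conn 1 1 diam_ge2.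
have exw := dist1_edge e_conn dxw; have ewz := dist1_edge e_conn dwz.
have xz : x != z by rewrite -(dist_eq0 e_conn) dxz.
have nexz : ~~ near x z.
  rewrite /near /= negb_or xz; apply/negP => exz.
  by have := dist_min e_conn (n := 1) (x := x) (y := z); rewrite walk1 dxz => /(_ exz).
have := @spread_card w [set x; z]; rewrite cards2 xz valency_split => spread.
suff: lambda.+1 * 2 <= lambda.+1 + b 1 by rewrite muln2 -addnn leq_add2l.
apply: spread => [y|y1 y2] /set2P[] ->; first by rewrite e_sym.
- by [].
- by case/set2P=> -> //; move/negP: nexz.
- by case/set2P=> -> //; rewrite near_sym; move/negP: nexz.
Qed.

(** Choose [a] in [A] with the least number x of neighbours in [S], and suppose
    x >= 2. Every neighbour [y] of [a] in [A] has at least x neighbours in [S];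
    those not adjacent to [a] are adjacent to no other neighbour of [a], by
    [common_nbr_unique]. If each [y] has such a neighbour, these and the
    neighbours of [a] in [S] are at least k vertices of [S]. If some [y] has
    none, the x neighbours of [a] in [S] lie in the clique of [y]; then the [b 1]
    neighbours of [a] outside this clique are in [A] and contribute x vertices
    each, which is again too many because [b 1 > lambda]. *)
Lemma sparse_boundary_vertex (S A : {set T}) : boundary_in e S A ->
  [disjoint A & S] -> #|S| < k -> A != set0 ->
  exists2 a, a \in A & #|[set u in S | e a u]| <= 1.
Proof.
move=> bdA disAS ltSk /set0Pn[a0 a0A].
have [a aA min_a] : exists2 a, a \in A &
    forall y, y \in A -> #|[set u in S | e a u]| <= #|[set u in S | e y u]|.
  by have [a] := arg_minnP (fun a => #|[set u in S | e a u]|) a0A; exists a.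
exists a => //; rewrite leqNgt; apply/negP.
set x := #|_| in min_a * => x_ge2.
pose S' := [set u in S | ~~ e a u]; pose A' := [set u in A | e a u].
have card_S : #|S| = x + #|S'|.
  rewrite -(cardsID [set u | e a u] S); congr (_ + _); apply: eq_card => u.
    by rewrite !inE.
  by rewrite !inE andbC.
have card_A' : k = x + #|A'|.
  rewrite -(degree a) -(cardsID S [set u | e a u]); congr (_ + _).
    by apply: eq_card => u; rewrite !inE andbC.
  apply: eq_card => u; rewrite !inE; case: (boolP (e a u)) => [eau|]; last first.
    by rewrite !andbF.
  have := bdA a u aA eau; rewrite !andbT inE.
  by case: (boolP (u \in A)) => [uA _|_ /= ->] //; rewrite (disjointFr disAS uA).
have sum_le : \sum_(y in A') #|[set u in S' | e y u]| <= #|S'|.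
  rewrite double_count -sum1_card; apply: leq_sum => u; rewrite inE => /andP[uS nau].
  apply/card_le1_eqP => y z; rewrite !inE => /andP[/andP[_ eay] euy] /andP[/andP[_ eaz] euz].
  apply: (common_nbr_unique (x := a) (y := u)) => //.
    by apply: contraTneq aA => ->; rewrite (disjointFl disAS).
  - by rewrite e_sym.
  - by rewrite e_sym.
have card_y y : y \in A' ->
    x <= #|[set u in S | e a u && e y u]| + #|[set u in S' | e y u]|.
  rewrite inE => /andP[yA eay]; apply: leq_trans (min_a y yA) _.
  rewrite -(cardsID [set u | e a u] [set u in S | e y u]) leq_add //.
    by apply: subset_leq_card; apply/subsetP => u; rewrite !inE andbAC andbA.
  by apply: subset_leq_card; apply/subsetP => u; rewrite !inE => /and3P[-> -> ->].
case: (boolP [exists y in A', x <= #|[set u in S | e a u && e y u]|]); last first.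
  move/exists_inPn => small_y.
  suff: #|A'| <= #|S'| by lia.
  apply: leq_trans sum_le; rewrite -sum1_card; apply: leq_sum => y yA'.
  by have := card_y y yA'; have := small_y y yA'; lia.
case/exists_inP => y; rewrite inE => /andP[yA eay] big_y.
have all_near u : u \in S -> e a u -> e y u.
  have : [set u in S | e a u && e y u] == [set u in S | e a u].
    rewrite eqEcard big_y andbT; apply/subsetP => v.
    by rewrite !inE => /and3P[-> ->].
  by move=> /eqP/setP/(_ u) + uS eau; rewrite !inE uS eau.
have [u0 /[!inE] /andP[u0S eau0]] : exists u, u \in [set u in S | e a u].
  by apply/card_gt0P; rewrite -/x ltnW.
have off_line z : e a z -> ~~ near y z -> {in S, forall u, e a u -> ~~ near z u}.
  move=> eaz nyz u uS eau; apply: contra nyz => nzu.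
  apply: (near_trans eay eau eaz); last by rewrite near_sym.
  by rewrite /near /= all_near ?orbT.
pose Y := [set z | e a z] :\: [set u in [set u | e a u] | near y u].
have card_Y : #|Y| = b 1.
  have sub : [set u in [set u | e a u] | near y u] \subset [set z | e a z].
    by apply/subsetP => z; rewrite inE => /andP[].
  by rewrite cardsD (setIidPr sub) degree card_line // valency_split addKn.
have sub_Y : Y \subset A'.
  apply/subsetP => z; rewrite !inE => /andP[+ eaz]; rewrite eaz andbT /= => nyz.
  have := bdA a z aA eaz; rewrite inE => /orP[//|zS].
  by have := off_line z eaz nyz z zS eaz; rewrite /near /= eqxx.
have : #|Y| * x <= #|S'|.
  apply: leq_trans sum_le; rewrite (big_setID Y) /= (setIidPr sub_Y).
  apply: leq_trans (leq_addr _ _); rewrite -sum_nat_const; apply: leq_sum => z zY.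
  apply: leq_trans (card_y z (subsetP sub_Y z zY)) _.
  have -> : [set u in S | e a u && e z u] = set0; last by rewrite cards0.
  apply/setP => u; rewrite !inE; apply/negbTE/negP => /and3P[uS eau ezu].
  move: zY; rewrite !inE => /andP[+ eaz]; rewrite eaz /= => nyz.
  by have := off_line z eaz nyz u uS eau; rewrite /near /= ezu orbT.
have := b1_gt_lambda; have := valency_split; rewrite card_Y; nia.
Qed.

Lemma card_layer1 x : #|layer e x 1| = k.
Proof. by rewrite layer1 degree. Qed.

Lemma card_layer2 x : #|layer e x 2| = k * b 1.
Proof.
by rewrite -(card_layer1 x) -(layer_count e_sym drg_e) // mu_eq1 muln1.
Qed.

Lemma layer1_avoided a (S B : {set T}) : boundary_in e S B -> a \notin B :|: S ->
  #|B :&: layer e a 1| = 0.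
Proof.
move=> bdB aBS; apply/eqP; rewrite cards_eq0; apply/eqP/setP => y.
rewrite layer1 !inE; apply/negbTE/negP => /andP[yB].
by rewrite e_sym => /(bdB _ _ yB); rewrite (negbTE aBS).
Qed.

(** [layer_flow], accumulated from layer 2 to layer [j] and cleared of
    denominators: the fraction of layer [j] in [B] is at most the fraction of
    layer 1 in [S], plus the number of vertices of [S] in the layers in between
    divided by a lower bound [K] for the sizes of these layers. *)
Lemma flow_bound a (S B : {set T}) K j : boundary_in e S B -> a \notin B :|: S ->
  2 <= j <= D -> (forall i, 2 <= i < j -> K <= #|layer e a i|) ->
  #|B :&: layer e a j| * (k * K) <= #|layer e a j| *
    (#|S :&: layer e a 1| * K + k * \sum_(2 <= i < j) #|S :&: layer e a i|).
Proof.
move=> bdB aBS; elim: j => // j IHj /andP[j2 jD] geK.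
have flow := layer_flow e_sym drg_e a bdB jD.
have [j1|j_ge2] : j = 1 \/ 2 <= j by lia.
  rewrite j1 card_layer1 in flow *; rewrite big_geq // muln0 addn0 mulnA.
  rewrite (layer1_avoided bdB aBS) add0n in flow.
  by rewrite [X in _ <= X]mulnA leq_mul2r [X in _ <= X]mulnC flow orbT.
have j_le : 2 <= j <= D by rewrite j_ge2 ltnW.
have geK' i : 2 <= i < j -> K <= #|layer e a i|.
  by move=> /andP[i2 ij]; apply: geK; rewrite i2 ltnS ltnW.
have {IHj geK'} IH := IHj j_le geK'; rewrite big_nat_recr //=.
move: IH; set s1 := #|S :&: layer e a 1|; set sigma := \sum_(2 <= i < j) _.
move=> IH.
have Kj : K <= #|layer e a j| by apply: geK; rewrite j_ge2 ltnSn.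
have kj := layer_gt0 e_sym drg_e a (ltnW jD).
rewrite -(leq_pmul2r kj).
move: flow IH Kj; set B' := #|B :&: _|; set k' := #|layer e a j.+1|.
set Bj := #|B :&: _|; set Sj := #|S :&: _|; set kk := #|layer e a j|.
move=> flow IH Kj.
apply: (@leq_trans ((Bj + Sj) * k' * (k * K))).
  by rewrite mulnAC leq_mul2r flow orbT.
have le_SK : Sj * (k * K) <= kk * (k * Sj).
  by rewrite mulnCA [X in _ <= X]mulnC -mulnA !leq_mul.
have := leq_mul (leqnn k') (leq_add IH le_SK); lia.
Qed.

(** [B] contains at most half of each layer from the second on, or of the second
    and the last one together. By [flow_bound] the first alternative holds at
    layer [j] if the layers between 2 and [j] are at least as large as layer 2.
    Of these, by [layer_mono], only layer [D.-1] can be smaller. If it is, [D] is at least 4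
    and layer [D] is at most as large as any layer between, so that [B] contains
    about |S| of its vertices at most, while it contains at most [b 1] of the
    k (b 1) vertices of layer 2. *)
Lemma far_side_half a (S B : {set T}) : boundary_in e S B -> a \notin B :|: S ->
  #|[set u in S | e a u]| <= 1 -> #|S| < k ->
  2 * #|B| + k < #|T|.
Proof.
move=> bdB aBS; set s1 := #|_| => s1_le1 ltSk.
have s1E : #|S :&: layer e a 1| = s1.
  by apply: eq_card => u; rewrite layer1 !inE.
have B0 : #|B :&: layer e a 0| = 0.
  apply/eqP; rewrite cards_eq0; apply/eqP/setP => y; rewrite (layer0 drg_e) !inE.
  by apply/negbTE/negP => /andP[yB /eqP ya]; rewrite -ya inE yB in aBS.
have B1 := layer1_avoided bdB aBS.
have k_split := valency_split.
have b1_gt := b1_gt_lambda.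
rewrite -/k in k_split.
have k2E := card_layer2 a.
have k4 : 4 <= k by lia.
have b2 : 2 <= b 1 by lia.
(* The difference of the two sides is [(k - 2) * (b 1 - 2)]. *)
have slack : 2 * (b 1 + (k - 2)) <= k * b 1 by nia.
have sum_S j : 2 <= j <= D -> s1 + \sum_(2 <= i < j) #|S :&: layer e a i| < k.
  move=> /andP[j2 jD]; apply: leq_ltn_trans ltSk.
  have jD1 : j <= D.+1 := leqW jD.
  rewrite (sum_layers e a S) (@big_cat_nat _ _ _ j 0) //=.
  rewrite (@big_cat_nat _ _ _ 2 0) //= (@big_cat_nat _ _ _ 1 0 2) //= !big_nat1 s1E.
  by rewrite -(addnA _ s1) -addnA addnCA leq_addr.
have bound j K := @flow_bound a S B K j bdB aBS; rewrite s1E in bound.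
have D2 : 2 <= D.+1 := leqW diam_ge2.
suff tail : 2 * \sum_(2 <= j < D.+1) #|B :&: layer e a j|
    <= \sum_(2 <= j < D.+1) #|layer e a j|.
  have := sum_layers e a setT; rewrite cardsT.
  under eq_bigr do rewrite setTI.
  rewrite (@big_cat_nat _ _ _ 2 0) //= (@big_cat_nat _ _ _ 1 0 2) //= !big_nat1.
  rewrite (layer0 drg_e) cards1 card_layer1 => ->.
  have := sum_layers e a B; rewrite (@big_cat_nat _ _ _ 2 0) //=.
  rewrite (@big_cat_nat _ _ _ 1 0 2) //= !big_nat1 B0 B1 => ->.
  by rewrite !add0n -addnA add1n ltnS addnC leq_add2l.
have half j : 2 <= j <= D ->
    (forall i, 2 <= i < j -> #|layer e a 2| <= #|layer e a i|) ->
    2 * #|B :&: layer e a j| <= #|layer e a j|.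
  move=> jD /(bound j _ jD); have := sum_S j jD; rewrite k2E.
  set sigma := \sum_(2 <= i < j) _; set Bj := #|_ :&: _|; set kj := #|_|.
  move=> ltk le_flow.
  have half_s : 2 * (s1 * b 1 + sigma) <= k * b 1.
    by case: s1 s1_le1 ltk {le_flow s1E bound sum_S} => [|[]] // _; lia.
  have kb : 0 < k * (k * b 1) by rewrite !muln_gt0; lia.
  rewrite -(leq_pmul2r kb); have := leq_mul (leqnn (kj * k)) half_s; lia.
have lower i : 2 <= i -> i + 2 <= D -> #|layer e a 2| <= #|layer e a i|.
  by move=> i2 iD; apply: (layer_mono e_sym drg_e); rewrite // addnC.
have [early_large|] := boolP ((D <= 3) || (#|layer e a 2| <= #|layer e a D.-1|)).
  rewrite big_distrr /= big_nat [X in _ <= X]big_nat leq_sum // => j jD.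
  apply: half => // i /andP[i2 ij].
  have [-> //|i_neq2] := eqVneq i 2.
  have [iD|i_neq] := eqVneq i D.-1; last by apply: lower => //; lia.
  by rewrite iD; case/orP: early_large => //; lia.
rewrite negb_or -!ltnNge => /andP[D4 last_small].
(* The sizes decrease from layer [D.-2] to layer [D.-1], and the ratio
   [b i / c i.+1] of consecutive sizes does not increase with [i]. *)
have kD_le : #|layer e a D| <= #|layer e a D.-1|.
  have D1 : D.-1.+1 = D by lia.
  have predD : D.-2.+1 = D.-1 by lia.
  have countD1 := layer_count e_sym drg_e a (i := D.-2) ltac:(lia).
  have countD := layer_count e_sym drg_e a (i := D.-1) ltac:(lia).
  have b_le := b_antitone drg_e (i := D.-2) ltac:(lia).
  have c_le := c_monotone e_sym drg_e (i := D.-1) ltac:(lia) ltac:(lia).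
  have cD := c_gt0 e_sym drg_e (i := D) ltac:(lia).
  have k_le := lower D.-2 ltac:(lia) ltac:(lia).
  rewrite predD in countD1 b_le; rewrite D1 in countD c_le.
  have bc : b D.-2 < c D.-1.
    rewrite -(ltn_pmul2l (layer_gt0 e_sym drg_e a (i := D.-2) ltac:(lia))).
    rewrite -countD1 ltn_pmul2r; first exact: leq_trans k_le.
    by apply: (c_gt0 e_sym drg_e); lia.
  rewrite -(leq_pmul2r cD) countD leq_mul2l; lia.
have ends : 2 * (#|B :&: layer e a 2| + #|B :&: layer e a D|)
    <= #|layer e a 2| + #|layer e a D|.
  (* For layer 2 the bound [K] is over an empty range, so 1 serves. *)
  have two : 2 <= 2 <= D by lia.
  have le_B2 := bound 2 1 two; have le_BD := bound D #|layer e a D|.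
  have kD0 := layer_gt0 e_sym drg_e a (leqnn D).
  have {le_B2} : #|B :&: layer e a 2| <= s1 * b 1.
    have := le_B2 _; rewrite big_geq // k2E => /(_ ltac:(lia)); nia.
  have {le_BD} := le_BD _ _; have := sum_S D; rewrite k2E.
  rewrite (leqnn D) andbT; set sigma := \sum_(2 <= i < D) _.
  set B2 := #|_ :&: layer e a 2|; set BD := #|_ :&: _|; set kD := #|layer e a D|.
  move=> /(_ diam_ge2) ltk /(_ diam_ge2) le_flow le_B2.
  have {le_flow} le_BD : BD * k <= s1 * kD + k * sigma.
    rewrite -(leq_pmul2l kD0) -/kD mulnCA [kD * k]mulnC; apply: le_flow => i /andP[i2 iD].
    have [->|i_neq] := eqVneq i D.-1; first exact: kD_le.
    apply: leq_trans kD_le _; apply: leq_trans (ltnW last_small) _.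
    by apply: lower => //; lia.
  rewrite -(leq_pmul2l (m := k)); last by lia.
  case: s1 s1_le1 {s1E bound sum_S} ltk le_B2 le_BD => [|[]] // _ ltk le_B2 le_BD.
    nia.
  have le_sigma : k * sigma <= k * (k - 2) by rewrite leq_mul2l; lia.
  have := leq_mul (leqnn k) slack; have := leq_mul (leqnn k) le_B2.
  have : 2 * kD <= k * kD by rewrite leq_mul2r; lia.
  lia.
have D3 : 3 <= D by apply: ltnW.
have split_ends (F : nat -> nat) :
    \sum_(2 <= j < D.+1) F j = (F 2 + F D) + \sum_(3 <= j < D) F j.
  rewrite big_nat_recr /=; last exact: ltnW.
  by rewrite (@big_cat_nat _ _ _ 3 2 D) //= big_nat1 addnAC.
rewrite !split_ends mulnDr leq_add //.
rewrite big_distrr /= big_nat [X in _ <= X]big_nat leq_sum // => j /andP[j3 jD].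
apply: half => [|i /andP[i2 ij]]; first by rewrite (ltnW j3) (ltnW jD).
by apply: lower => //; lia.
Qed.

(** If [S] were smaller, then by [far_side_half], applied from a vertex on either
    side, both sides would have less than (v - k) / 2 of the v vertices, and more
    than k vertices would remain for [S]. *)
Theorem vertex_connectivity (S A : {set T}) : boundary_in e S A ->
  [disjoint A & S] -> A != set0 -> A :|: S != setT -> k <= #|S|.
Proof.
move=> bdA disAS A0 AS; rewrite leqNgt; apply/negP => ltSk.
pose B := ~: (A :|: S).
have bdB : boundary_in e S B.
  move=> x y xB exy; rewrite inE; case: (boolP (y \in S)) => yS; first by rewrite orbT.
  rewrite orbF inE inE (negbTE yS) orbF; apply/negP => yA.
  by move: xB; rewrite inE => /negP[]; apply: (bdA y); rewrite // e_sym.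
have disBS : [disjoint B & S].
  rewrite disjoint_subset; apply/subsetP => x.
  by rewrite !inE negb_or => /andP[].
have B0 : B != set0 by rewrite -setCT (inj_eq (@setC_inj T)).
have sparse := sparse_boundary_vertex.
have [a aA sa] := sparse _ _ bdA disAS ltSk A0.
have [y yB sy] := sparse _ _ bdB disBS ltSk B0.
have aBS : a \notin B :|: S by rewrite !inE aA (disjointFr disAS aA).
have yAS : y \notin A :|: S by rewrite inE in yB.
have := far_side_half bdB aBS sa ltSk.
have := far_side_half bdA yAS sy ltSk.
have := cardsC (A :|: S); rewrite -/B; have := cardsUI A S.
lia.
Qed.

(** * Extending matchings *)

(** [X] represents components of the complement of [W]. The boundary of each
    component separates it from another one, hence has at least k vertices. A
    vertex of [W] has neighbours in at most k / lambda.+1 components: neighbours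
    chosen in distinct components lie in distinct cliques around it. *)
Lemma separator_bound (W X : {set T}) : X \subset ~: W -> 1 < #|X| ->
  {in X &, forall x y, connect_in e (~: W) x y -> x = y} ->
  k <= #|W| /\ lambda.+1 * #|X| <= #|W|.
Proof.
move=> /subsetP XW X_gt1 discX.
pose comp x := [set y | connect_in e (~: W) x y].
pose adj := [rel x w | [exists y in comp x, e w y]].
have comp_in x y : x \in X -> y \in comp x -> y \in ~: W.
  move=> /XW xW; rewrite inE => /connectP[p ep ->].
  by elim: p x xW ep => //= z p IHp x _ /andP[/and3P[_ zW _]]; apply: IHp.
have comp_step x y z : x \in X -> y \in comp x -> e y z -> z \in ~: W -> z \in comp x.
  move=> xX yx eyz zW; have yW := comp_in x y xX yx.
  rewrite !inE in yx *; apply: connect_trans yx (connect1 _).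
  by rewrite /= yW zW.
have comp_sym : connect_sym [rel x y | [&& x \in ~: W, y \in ~: W & e x y]].
  by apply: sym_connect_sym => x y /=; rewrite e_sym andbCA.
have comp_eq x x' y : x \in X -> x' \in X -> y \in comp x -> y \in comp x' -> x = x'.
  rewrite !inE => xX x'X xy x'y; apply: discX => //.
  by apply: connect_trans xy _; rewrite comp_sym.
have comp_refl x : x \in comp x by rewrite inE; apply: connect0.
have boundary x : x \in X -> k <= #|[set w in W | adj x w]|.
  move=> xX; apply: (vertex_connectivity (A := comp x)).
  - move=> y z yx eyz; rewrite inE; have [zW|zW] := boolP (z \in W).
      by apply/orP; right; rewrite inE zW; apply/existsP; exists y; rewrite yx e_sym.
    by rewrite (comp_step x y z) // inE.
  - rewrite disjoint_subset; apply/subsetP => y /(comp_in x y xX).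
    by rewrite !inE => /negbTE ->.
  - by apply/set0Pn; exists x.
  - have [x' x'X x'x] : exists2 x', x' \in X & x' != x.
      move: X_gt1; rewrite (cardsD1 x) xX ltnS => /card_gt0P[x'].
      by rewrite !inE => /andP[? ?]; exists x'.
    apply/eqP => /setP/(_ x'); rewrite in_setT in_setU.
    have := XW x' x'X; rewrite [x' \in ~: W]inE [x' \in [set w in W | _]]inE.
    move=> /negbTE ->; rewrite orbF => x'C.
    by rewrite (comp_eq x' x x') ?eqxx // in x'x.
have touching w : w \in W -> lambda.+1 * #|[set x in X | adj x w]| <= k.
  move=> wW; pose rep x := odflt x [pick y in comp x | e w y].
  have repP x : adj x w -> rep x \in comp x /\ e w (rep x).
    rewrite /rep; case: pickP => [y /andP[]//|no] /existsP[y].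
    by rewrite no.
  have rep_eq x x' : x \in [set x in X | adj x w] -> x' \in [set x in X | adj x w] ->
      near (rep x) (rep x') -> x = x'.
    rewrite !inE => /andP[xX /repP[rx _]] /andP[x'X /repP[rx' _]] near_r.
    apply: (comp_eq x x' (rep x')) => //; case/orP: near_r => [/eqP <- //|e_r].
    by apply: (comp_step x (rep x)) => //; apply: (comp_in x').
  rewrite -(card_in_imset (f := rep)) => [|x x' xX x'X rr].
    apply: (spread_card (p := w)).
      by move=> _ /imsetP[x /[!inE] /andP[_ /repP[_]] + ->].
    by move=> _ _ /imsetP[x xX ->] /imsetP[x' x'X ->] /(rep_eq x x' xX x'X) ->.
  by apply: rep_eq; rewrite // /near /= rr eqxx.
have k_gt0 : 0 < k.
  by rewrite valency_split.
split.
  have /card_gt0P[x xX] := ltnW X_gt1; apply: leq_trans (boundary x xX) _.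
  by apply: subset_leq_card; apply/subsetP => w; rewrite inE => /andP[].
rewrite -(leq_pmul2r k_gt0).
have le1 : #|X| * k <= \sum_(x in X) #|[set w in W | adj x w]|.
  by rewrite -sum_nat_const leq_sum.
rewrite double_count in le1.
rewrite -mulnA; apply: leq_trans (leq_mul (leqnn _) le1) _.
by rewrite big_distrr /= -sum_nat_const leq_sum.
Qed.

(** A barrier of the graph without the vertices of [M], enlarged by these vertices,
    leaves too many components for [separator_bound]. *)
Lemma matching_extends (M : {set {set T}}) : ~~ odd #|T| -> matching e M ->
  2 * #|M| * lambda.+1 <= k * lambda + lambda.+1 ->
  exists2 P, perfect_matching e P & M \subset P.
Proof.
move=> evenT mM small_M; have cM := card_cover_matching e_irr mM.
have [f [S [X [mf sS sX discX leX]]]] := berge_barrier e_sym e_irr (~: cover M).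
apply: (matching_glue mM mf); apply/eqP; rewrite -cards_eq0.
apply/negPn/negP => miss_n0.
have miss_ge2 : 1 < #|missed (~: cover M) f|.
  have := odd_missed mf; have := cardsC (cover M); rewrite cM.
  by move: miss_n0 evenT; case: #|missed _ _| => [|[|n]] // _ evenT cT; lia.
set W := cover M :|: S.
have WE : ~: W = ~: cover M :\: S by rewrite setCU setDE.
have cW : #|W| = 2 * #|M| + #|S|.
  rewrite -cM cardsU; have -> : cover M :&: S = set0; last by rewrite cards0 subn0.
  by apply/eqP; rewrite setI_eq0 disjoint_sym disjoints_subset.
rewrite -WE in sX discX.
have [|W_ge_k X_le] := separator_bound sX _ discX; first by lia.
nia.
Qed.

(** Count a vertex, its neighbours and one vertex at distance 2. *)
Lemma order_gt : k.+1 < #|T|.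
Proof.
have [x [_ [z [_ _ dxz]]]] := @exists_dist _ _ drg_e.1 1 1 diam_ge2.
rewrite -(card_layer1 x).
have : [set x; z] :|: layer e x 1 \subset [set: T] by apply: subsetT.
move=> /subset_leq_card; rewrite cardsT -setUA !cardsU1 !inE dxz /=.
have xz : x != z by rewrite -(dist_eq0 drg_e.1) dxz.
by rewrite (negbTE xz) (distxx drg_e.1).
Qed.

End MuOne.

Section Floor.
Import GRing.Theory Num.Theory.
Local Open Scope ring_scope.

(** With t the integer part below, 2 t is at most k + 1 - k / (lambda + 1);
    multiply by [lambda.+1]. *)
Lemma floor_half_bound (k lambda : nat) :
  (2 * `|Num.floor ((k%:R + 1 - k%:R / (lambda%:R + 1)) / 2 : rat)|
     * lambda.+1 <= k * lambda + lambda.+1)%N.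
Proof.
set q : rat := _ / 2.
have l_ge0 : 0 <= lambda%:R :> rat by apply: ler0n.
have k_ge0 : 0 <= k%:R :> rat by apply: ler0n.
have qE : q * 2 * (lambda%:R + 1) = k%:R * lambda%:R + (lambda%:R + 1).
  by rewrite /q; field; rewrite lt0r_neq0 // ltr_wpDl.
have q_ge0 : 0 <= q.
  rewrite -(pmulr_lge0 _ (x := 2 * (lambda%:R + 1))); last by nra.
  by rewrite mulrA qE; nra.
have tE : (`|Num.floor q|%N)%:R = (Num.floor q)%:~R :> rat.
  by rewrite -[in RHS](gez0_abs (m := Num.floor q)) // floor_ge0.
rewrite -(ler_nat rat) natrD !natrM -[lambda.+1%:R]natr1 -qE tE.
have := floor_le q; nra.
Qed.

End Floor.

Theorem theorem3p14 (T : finType) (e : rel T) (b c : nat -> nat) (k lambda : nat)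
  (simple_e : simple_graph e)
  (drg_e : distance_regular e b c)
  (even_order : ~~ odd #|T|)
  (valency : k = b 0)
  (lambdaP : forall x y : T, e x y -> #|common_nbrs e x y| = lambda)
  (lambda_ge1 : 1 <= lambda)
  (diam_ge2 : 2 <= diameter e)
  (mu_eq1 : c 2 = 1) :
  (* the rational number under the floor is nonnegative, so the absolute value
     only converts its integer part to nat *)
  extendable e
    `|Num.floor ((k%:R + 1 - k%:R / (lambda%:R + 1)) / 2 : rat)%R|%N.
Proof.
have [e_sym e_irr] := simple_e.
have := floor_half_bound k lambda; set t := `|_|%N => t_bound.
have extends (M : {set {set T}}) : matching e M -> #|M| <= t ->
    exists2 P, perfect_matching e P & M \subset P.
  move=> mM Mt; apply: (matching_extends e_sym e_irr drg_e lambdaP) => //.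
  rewrite -valency; apply: leq_trans t_bound.
  by rewrite leq_mul2r leq_mul2l Mt orbT.
split=> //; first exact: drg_e.1.
- have [||P mP _] := extends set0; rewrite ?cards0 //; last by exists P.
  by rewrite /matching sub0set; apply/trivIsetP => A B; rewrite inE.
- have := order_gt e_irr drg_e diam_ge2.
  have := valency_split e_sym e_irr drg_e lambdaP diam_ge2.
  have := b1_gt_lambda e_sym e_irr drg_e lambdaP diam_ge2 mu_eq1.
  rewrite -valency => b1_gt k_split v_gt.
  have : 2 * t < k by nia.
  lia.
- by move=> M mM cM; apply: extends; rewrite ?cM.
Qed.
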